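(* Let $n\ge 2$, let $X_1,\dots,X_n$ be complex Banach spaces, and let $D_1\in\mathcal{B}(X_1),\ D_2\in\mathcal{B}(X_2),\dots,D_n\in\mathcal{B}(X_n)$. Assume that $D_s$ is inner regular for every $2\le s\le n-1$. Consider the following statements: (i) (a) $D_1\in\mathcal{G}_l(X_1)$ and $D_n\in\mathcal{G}_r(X_n)$; and (b) $\mathcal{N}(D_{i+1})\cong\mathcal{K}(D_i)$ for $1\le i\le n-1$; (ii) there exists $A\in\mathcal{B}_n$ such that $T_n^d(A)\in\mathcal{G}(X_1\oplus\cdots\oplus X_n)$; (iii) (a) $D_1\in\mathcal{G}_l(X_1)$ and $D_n\in\mathcal{G}_r(X_n)$; and (b) for every $2\le i\le n$ the relation $\bigoplus_{s=1}^{i-1}\mathcal{K}(D_s)\prec\mathcal{N}(D_i)$ does not hold, and for every $1\le i\le n-1$ the relation $\bigoplus_{s=i+1}^{n}\mathcal{N}(D_s)\prec\mathcal{K}(D_i)$ does not hold. Then (i) implies (ii). If moreover $X_1,\dots,X_n$ are infinite dimensional Hilbert spaces, then (ii) implies (iii).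
   Context: For Banach spaces $X,Y$, $\mathcal{B}(X,Y)$ is the set of bounded linear operators from $X$ to $Y$, and $\mathcal{B}(X)=\mathcal{B}(X,X)$. $\mathcal{N}(T)$ and $\mathcal{R}(T)$ denote the kernel and the range of $T$. $X\cong Y$ means that there is an invertible operator in $\mathcal{B}(X,Y)$. No separability is assumed. Given $D_i\in\mathcal{B}(X_i)$, $1\le i\le n$, let $\mathcal{B}_n$ be the set of all tuples $A=(A_{ij})_{1\le i<j\le n}$ with $A_{ij}\in\mathcal{B}(X_j,X_i)$. For $A\in\mathcal{B}_n$, $T_n^d(A)\in\mathcal{B}(X_1\oplus\cdots\oplus X_n)$ is the upper triangular $n\times n$ operator matrix with diagonal entries $D_1,\dots,D_n$, with $(i,j)$ entry $A_{ij}$ for $i<j$, and with $(i,j)$ entry $0$ for $i>j$. An operator $T\in\mathcal{B}(X,Y)$ is left (right) invertible if $ST=I$ ($TS=I$) for some $S\in\mathcal{B}(Y,X)$. $\mathcal{G}_l(X)$ and $\mathcal{G}_r(X)$ are the sets of left, respectively right, invertible operators in $\mathcal{B}(X)$, and $\mathcal{G}(X)=\mathcal{G}_l(X)\cap\mathcal{G}_r(X)$ is the set of invertible operators. $T\in\mathcal{B}(X)$ is inner regular if $T=T\widetilde{T}T$ for some $\widetilde{T}\in\mathcal{B}(X)$; equivalently, $\mathcal{N}(T)$ and $\mathcal{R}(T)$ are closed and complemented subspaces of $X$. Left invertible and right invertible operators are inner regular. For $T\in\mathcal{B}(X)$ such that $\overline{\mathcal{R}(T)}$ is complemented in $X$,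 $\mathcal{K}(T)$ denotes a topological complement of $\overline{\mathcal{R}(T)}$ in $X$ (unique up to isomorphism; in a Hilbert space one may take $\mathcal{R}(T)^\perp$). For Banach spaces $X,Y$, write $X\preceq Y$ if there is a left invertible operator from $X$ to $Y$. Write $X\prec Y$ if $X\preceq Y$ and $Y/\mathcal{R}(T)$ is an infinite dimensional linear space for every $T\in\mathcal{B}(X,Y)$. (If $X,Y$ are Hilbert spaces, then $X\preceq Y$ iff $\dim X\le\dim Y$, and $X\prec Y$ iff $\dim X<\dim Y$ and $\dim Y=\infty$, where $\dim$ is the orthogonal dimension.) *)

(* Defs.v *)
From HB Require Import structures.
From mathcomp Require Import all_boot all_order all_algebra.
From mathcomp Require Import sesquilinear ring_quotient generic_quotient.
From mathcomp Require Import complex.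
From mathcomp Require Import boolp classical_sets functions filter reals topology.
From mathcomp Require Import normedtype.

Set Implicit Arguments.
Unset Strict Implicit.
Unset Printing Implicit Defensive.

Import Order.TTheory GRing.Theory Num.Theory.
Import numFieldNormedType.Exports.

Local Open Scope classical_set_scope.
Local Open Scope ring_scope.
Local Open Scope quotient_scope.

Section BoundedOperators.
Context {K : numFieldType}.
Implicit Types X Y : completeNormedModType K.

(* Norms take their values in K itself. For K := R[i] the order is the partial
   one of R[i], where `0 <= z` says that z is a nonnegative real number; a bound
   M as below is therefore automatically real unless X = 0. *)
Record boundedOp X Y := BoundedOp {
  bop_linear :> {linear X -> Y};
  bop_bounded : exists M : K, forall x, `|bop_linear x| <= M * `|x| }.

Definition left_invertible X Y (T : boundedOp X Y) : Prop :=
  exists S : boundedOp Y X, forall x, S (T x) = x.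

Definition right_invertible X Y (T : boundedOp X Y) : Prop :=
  exists S : boundedOp Y X, forall y, T (S y) = y.

Definition invertible X Y (T : boundedOp X Y) : Prop :=
  left_invertible T /\ right_invertible T.

Definition isomorphic X Y : Prop := exists T : boundedOp X Y, invertible T.

Definition inner_regular X (T : boundedOp X X) : Prop :=
  exists T' : boundedOp X X, forall x, T (T' (T x)) = T x.

Lemma bop_bounded_ge0 X Y (T : boundedOp X Y) :
  exists2 M : K, 0 <= M & forall x, `|T x| <= M * `|x|.
Proof.
have [M TM] := bop_bounded T; exists `|M| => // x.
have M0 : 0 <= M * `|x| := le_trans (normr_ge0 _) (TM x).
by rewrite (le_trans (TM x))// -{1}(ger0_norm M0) normrM normr_id.
Qed.

Lemma bop_continuous X Y (T : boundedOp X Y) : continuous T.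
Proof.
apply/linear_bounded_continuous/bounded_funP => r.
have [M M0 TM] := bop_bounded_ge0 T.
by exists (M * r) => x xr; rewrite (le_trans (TM x))// ler_wpM2l.
Qed.

End BoundedOperators.

Section ClosedSubspaces.
Context {K : numFieldType}.
Implicit Type X : completeNormedModType K.

Record closedSubspace X := ClosedSubspace {
  cs_set :> set X;
  cs_zero : cs_set 0;
  cs_linear : forall a x y, cs_set x -> cs_set y -> cs_set (a *: x + y);
  cs_closed : closed cs_set }.

Definition cs_pred X (S : closedSubspace X) : {pred X} := fun x => x \in cs_set S.

Lemma cs_pred_submod X (S : closedSubspace X) : submod_closed (cs_pred S).
Proof.
split; first by apply/mem_set; exact: cs_zero.
by move=> a x y /set_mem Sx /set_mem Sy; apply/mem_set; exact: cs_linear.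
Qed.

HB.instance Definition _ X (S : closedSubspace X) :=
  GRing.isSubmodClosed.Build K X (cs_pred S) (cs_pred_submod S).

Definition cs_type X (S : closedSubspace X) := {x : X | cs_pred S x}.

HB.instance Definition _ X (S : closedSubspace X) :=
  SubChoice.on (cs_type S).
HB.instance Definition _ X (S : closedSubspace X) :=
  [SubChoice_isSubLmodule of cs_type S by <:].


Section SubspaceNorm.
Variables (X : completeNormedModType K) (S : closedSubspace X).

Definition cs_norm (x : cs_type S) : K := `|val x|.

Lemma cs_ler_normD x y : cs_norm (x + y) <= cs_norm x + cs_norm y.
Proof. exact: ler_normD. Qed.

Lemma cs_normrZ (a : K) x : cs_norm (a *: x) = `|a| * cs_norm x.
Proof. exact: normrZ. Qed.

Lemma cs_normr0_eq0 x : cs_norm x = 0 -> x = 0.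
Proof. by move=> /normr0_eq0 x0; apply: val_inj. Qed.

HB.instance Definition _ := @Lmodule_isNormed.Build K (cs_type S)
  cs_norm cs_ler_normD cs_normrZ cs_normr0_eq0.

Lemma cs_normE (x : cs_type S) : `|x| = `|val x|.
Proof. by []. Qed.

Lemma cs_complete (F : set_system (cs_type S)) :
  ProperFilter F -> cauchy F -> cvg F.
Proof.
move=> FF /cauchy_ballP Fc.
have G : cauchy (val @ F).
  apply/cauchy_ballP => e e0; have [/= [A B] [/= FA FB] AB] := Fc e e0.
  exists ((val : cs_type S -> X) @` A, (val : cs_type S -> X) @` B) => /=.
    by split; [apply: filterS FA|apply: filterS FB] => z Az; exists z.
  move=> [x y] /= [[a Aa <-] [b Bb <-]].
  by have := AB (a, b) (conj Aa Bb); rewrite /= -!ball_normE.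
have /cvg_ex[l Fl] : cvg (val @ F) by exact: cauchy_cvg.
have Sl : cs_set S l.
  refine (@closed_cvg _ _ F FF val (cs_set S) (@cs_closed _ S) _ l Fl).
  by apply: nearW => x; have := valP x => /set_mem.
apply/cvg_ex; exists (exist _ l (mem_set Sl) : cs_type S).
apply/cvgrPdist_lt => e e0; move/cvgrPdist_lt: Fl => /(_ e e0).
exact.
Qed.

HB.instance Definition _ := Uniform_isComplete.Build (cs_type S) cs_complete.

End SubspaceNorm.
End ClosedSubspaces.

(* A closed subspace, viewed as a Banach space with the restricted norm. *)
Coercion cs_type : closedSubspace >-> Sortclass.


Section DirectSum.
Context {K : numFieldType}.
Variables (I : finType) (X : I -> completeNormedModType K).

Definition dsum : Type := forall i, X i.

HB.instance Definition _ := Choice.copy dsum (forall i, X i).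

Implicit Types x y z : dsum.

Let addA : associative (fun x y : dsum => (fun i => x i + y i) : dsum).
Proof. by move=> x y z; apply: functional_extensionality_dep => i; rewrite addrA. Qed.

Let addC : commutative (fun x y : dsum => (fun i => x i + y i) : dsum).
Proof. by move=> x y; apply: functional_extensionality_dep => i; rewrite addrC. Qed.

Let add0 : left_id ((fun=> 0) : dsum) (fun x y : dsum => (fun i => x i + y i) : dsum).
Proof. by move=> x; apply: functional_extensionality_dep => i; rewrite add0r. Qed.

Let addN : left_inverse ((fun=> 0) : dsum) (fun x : dsum => (fun i => - x i) : dsum)
  (fun x y : dsum => (fun i => x i + y i) : dsum).
Proof. by move=> x; apply: functional_extensionality_dep => i; rewrite addNr. Qed.

HB.instance Definition _ := GRing.isZmodule.Build dsum addA addC add0 addN.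

Let scale (a : K) x : dsum := fun i => a *: x i.

Let scaleA a b x : scale a (scale b x) = scale (a * b) x.
Proof. by apply: functional_extensionality_dep => i; rewrite /scale scalerA. Qed.

Let scale1 : left_id 1 scale.
Proof. by move=> x; apply: functional_extensionality_dep => i; rewrite /scale scale1r. Qed.

Let scaleDr : right_distributive scale +%R.
Proof. by move=> a x y; apply: functional_extensionality_dep => i; exact: scalerDr. Qed.

Let scaleDl x : {morph scale^~ x : a b / a + b}.
Proof. by move=> a b; apply: functional_extensionality_dep => i; exact: scalerDl. Qed.

HB.instance Definition _ :=
  GRing.Zmodule_isLmodule.Build K dsum scaleA scale1 scaleDr scaleDl.

(* The l^1 norm is one of the equivalent norms of a finite direct sum; bounded
   operators, their inverses and their ranges do not depend on this choice. *)
Definition dsum_norm x : K := \sum_i `|x i|.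

Let ler_dsum_normD x y : dsum_norm (x + y) <= dsum_norm x + dsum_norm y.
Proof. by rewrite -big_split; apply: ler_sum => i _; exact: ler_normD. Qed.

Let dsum_normrZ (a : K) x : dsum_norm (a *: x) = `|a| * dsum_norm x.
Proof. by rewrite [RHS]mulr_sumr; apply: eq_bigr => i _; exact: normrZ. Qed.

Let dsum_normr0_eq0 x : dsum_norm x = 0 -> x = 0.
Proof.
move=> x0; apply: functional_extensionality_dep => i; apply/eqP.
rewrite -normr_eq0; move/eqP: x0; rewrite psumr_eq0 => [/allP|j _]; last exact: normr_ge0.
by apply; rewrite mem_index_enum.
Qed.

HB.instance Definition _ := @Lmodule_isNormed.Build K dsum
  dsum_norm ler_dsum_normD dsum_normrZ dsum_normr0_eq0.

Lemma dsum_normE x : `|x| = \sum_i `|x i|.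
Proof. by []. Qed.

Lemma ler_dsum_coord x i : `|x i| <= `|x|.
Proof. by rewrite dsum_normE (bigD1 i)//= lerDl sumr_ge0. Qed.

Lemma dsum_complete (F : set_system dsum) :
  ProperFilter F -> cauchy F -> cvg F.
Proof.
move=> FF /cauchy_ballP Fc.
have G i : cvg ((fun x : dsum => x i) @ F).
  apply: cauchy_cvg; apply/cauchy_ballP => e e0.
  have [/= [A B] [/= FA FB] AB] := Fc e e0.
  exists ((fun x : dsum => x i) @` A, (fun x : dsum => x i) @` B) => /=.
    by split; [apply: filterS FA|apply: filterS FB] => z Az; exists z.
  move=> [x y] /= [[a Aa <-] [b Bb <-]].
  have := AB (a, b) (conj Aa Bb); rewrite /= -!ball_normE /=.
  exact/le_lt_trans/(ler_dsum_coord (a - b)).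
pose l : dsum := fun i => lim ((fun x : dsum => x i) @ F).
apply/cvg_ex; exists l; apply/cvgrPdist_lt => e e0.
have e1 : 0 < e / #|I|.+1%:R by rewrite divr_gt0.
have : \forall x \near F, forall i, `|l i - x i| < e / #|I|.+1%:R.
  by apply: filter_forall => i; have /cvgrPdist_lt := G i; apply.
apply: filterS => x lx; rewrite dsum_normE.
apply: (@le_lt_trans _ _ (\sum_(i : I) e / #|I|.+1%:R)).
  by apply: ler_sum => i _; exact/ltW/lx.
rewrite sumr_const -[ltLHS]mulr_natr -mulrA gtr_pMr// mulrC ltr_pdivrMr// mul1r.
by rewrite ltr_nat.
Qed.

HB.instance Definition _ := Uniform_isComplete.Build dsum dsum_complete.

End DirectSum.

Section QuotientModule.
Context {K : numFieldType}.
Variables (V : lmodType K) (W : submodClosed V).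

(* MathComp has the quotient of an abelian group by a subgroup, but no K-module
   structure on it; submod_pred only records that W is a subgroup. *)
Definition submod_pred : {pred V} := fun x => x \in W.

HB.instance Definition _ := GRing.isZmodClosed.Build V submod_pred
  (GRing.submod_closedB (submodClosedP W)).

Definition quotient_module := Quotient.quot submod_pred.

HB.instance Definition _ := GRing.Zmodule.on quotient_module.
HB.instance Definition _ := EqQuotient.on quotient_module.

Implicit Types u v : quotient_module.

Let scale (a : K) u : quotient_module := \pi_quotient_module (a *: repr u).

Let scale_pi a x : scale a (\pi_quotient_module x) = \pi_quotient_module (a *: x).
Proof.
apply/eqP; rewrite -Quotient.idealrBE -scalerBr.
have : (repr (\pi_quotient_module x) - x) \in submod_pred.
  by rewrite Quotient.idealrBE reprK.
exact: (@rpredZ _ _ W).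
Qed.

Let pi_add x y : \pi_quotient_module (x + y) =
  \pi_quotient_module x + \pi_quotient_module y.
Proof. by rewrite !piE. Qed.

Let pi_surj u : exists x, u = \pi_quotient_module x.
Proof. by exists (repr u); rewrite reprK. Qed.

Let scaleA a b u : scale a (scale b u) = scale (a * b) u.
Proof.
have [x ->] := pi_surj u.
by rewrite (scale_pi b x) (scale_pi a) (scale_pi (a * b)) scalerA.
Qed.

Let scale1 : left_id 1 scale.
Proof. by move=> u; have [x ->] := pi_surj u; rewrite (scale_pi 1 x) scale1r. Qed.

Let scaleDr : right_distributive scale +%R.
Proof.
move=> a u v; have [x ->] := pi_surj u; have [y ->] := pi_surj v.
by rewrite -(pi_add x y) (scale_pi a x) (scale_pi a y) (scale_pi a (x + y))
  scalerDr (pi_add (a *: x)).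
Qed.

Let scaleDl u : {morph scale^~ u : a b / a + b}.
Proof.
move=> a b; have [x ->] := pi_surj u.
by rewrite (scale_pi a x) (scale_pi b x) (scale_pi (a + b) x)
  scalerDl (pi_add (a *: x)).
Qed.

HB.instance Definition _ := GRing.Zmodule_isLmodule.Build K quotient_module
  scaleA scale1 scaleDr scaleDl.

Lemma quotient_moduleZ a x :
  \pi_quotient_module (a *: x) = a *: \pi_quotient_module x.
Proof. by rewrite -scale_pi. Qed.

Lemma quotient_moduleD x y :
  \pi_quotient_module (x + y) = \pi_quotient_module x + \pi_quotient_module y.
Proof. exact: pi_add. Qed.

Lemma quotient_module_eq x y :
  (\pi_quotient_module x = \pi_quotient_module y) <-> (x - y \in W).
Proof.
have xyE : (x - y \in W) = (\pi_quotient_module x == \pi_quotient_module y).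
  by rewrite -Quotient.idealrBE.
by rewrite xyE; split=> /eqP.
Qed.

End QuotientModule.

Definition finite_dimensional {K : numFieldType} (V : lmodType K) : Prop :=
  exists s : seq V, forall v, exists c : 'I_(size s) -> K,
    v = \sum_(i < size s) c i *: s`_i.

Definition infinite_dimensional {K : numFieldType} (V : lmodType K) : Prop :=
  ~ finite_dimensional V.

Section KernelRange.
Context {K : numFieldType}.
Variables (X Y : completeNormedModType K) (T : boundedOp X Y).

Let ker_set : set X := [set x | T x = 0].

Let ker_linear a x y : ker_set x -> ker_set y -> ker_set (a *: x + y).
Proof. by rewrite /ker_set/= linearP => -> ->; rewrite scaler0 addr0. Qed.

Let ker_closed : closed ker_set.
Proof.
apply: (@closed_comp _ _ T [set 0]); last exact/accessible_closed_set1/hausdorff_accessible/norm_hausdorff.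
by move=> x _; exact: bop_continuous.
Qed.

Definition ker : closedSubspace X :=
  ClosedSubspace (linear0 T) ker_linear ker_closed.

Definition range_pred : {pred Y} := fun y => y \in range T.

Let range_submod : submod_closed range_pred.
Proof.
split; first by apply/mem_set; exists 0 => //; exact: linear0.
move=> a _ _ /set_mem[x _ <-] /set_mem[y _ <-]; apply/mem_set.
by exists (a *: x + y); rewrite // linearP.
Qed.

HB.instance Definition _ := GRing.isSubmodClosed.Build K Y range_pred range_submod.

(* The linear space Y / R(T); it is purely algebraic, as R(T) may not be closed. *)
Definition coker : lmodType K := quotient_module range_pred.

Let clrange_linear a x y : closure (range T) x -> closure (range T) y ->
  closure (range T) (a *: x + y).
Proof.
move=> clx cly B /= /nbhs_normP[e /= e0 eB].
have d0 : 0 < e / 2 / (`|a| + 1) by rewrite !divr_gt0// ltr_wpDl.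
have [_ [[u _ <-] /= xu]] := clx _ (nbhsx_ballx x _ d0).
have e20 : 0 < e / 2 by rewrite divr_gt0.
have [_ [[v _ <-] /= yv]] := cly _ (nbhsx_ballx y _ e20).
exists (a *: T u + T v); split; first by exists (a *: u + v); rewrite // linearP.
apply: eB => /=; rewrite -ball_normE/= in xu; rewrite -ball_normE/= in yv.
rewrite opprD addrACA -scalerBr (le_lt_trans (ler_normD _ _))// normrZ.
rewrite [ltRHS]splitr; apply: ler_ltD => //.
apply: (@le_trans _ _ (`|a| * (e / 2 / (`|a| + 1)))).
  by apply: ler_wpM2l => //; exact: ltW.
by rewrite mulrCA ger_pMr// ler_pdivrMr ?mul1r ?lerDl// ltr_wpDl.
Qed.

Definition closure_range : closedSubspace Y :=
  ClosedSubspace (subset_closure (ex_intro2 _ _ 0 I (linear0 T)))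
    clrange_linear (@closed_closure _ (range T)).

End KernelRange.

Section Relations.
Context {K : numFieldType}.
Implicit Types X Y : completeNormedModType K.

Definition preceq X Y : Prop := exists T : boundedOp X Y, left_invertible T.

Definition prec X Y : Prop :=
  preceq X Y /\ forall T : boundedOp X Y, infinite_dimensional (coker T).

(* Both summands are closed by their type, so that an algebraic direct sum is
   enough for a topological complement in a Banach space. *)
Definition topological_complement X (M L : closedSubspace X) : Prop :=
  (forall x, exists u v, [/\ cs_set M u, cs_set L v & x = u + v]) /\
  M `&` L = [set 0].

Definition complemented X (M : closedSubspace X) : Prop :=
  exists L : closedSubspace X, topological_complement M L.

End Relations.

(* `dot` is linear in its first argument and conjugate linear in the second. *)
Definition hilbert {C : numClosedFieldType} (X : completeNormedModType C) : Prop :=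
  exists dot : {dot X for Num.conj}, forall x, `|x| ^+ 2 = dot x x.

Section UpperTriangular.
Context {K : numFieldType}.
Variables (n : nat) (X : 'I_n -> completeNormedModType K).

Definition strictly_upper : Type :=
  forall i j : 'I_n, (i < j)%N -> boundedOp (X j) (X i).

Variables (D : forall i, boundedOp (X i) (X i)) (A : strictly_upper).

Definition upper_triangular_fun (x : dsum X) : dsum X := fun i =>
  D i (x i) + \sum_(j : {j : 'I_n | (i < j)%N}) A (valP j) (x (val j)).

Let upper_triangular_is_linear : linear upper_triangular_fun.
Proof.
move=> a x y; apply: functional_extensionality_dep => i.
have dsumE j (u v : dsum X) : (a *: u + v) j = a *: u j + v j by [].
rewrite dsumE /upper_triangular_fun dsumE linearP scalerDr addrACA; congr +%R.
rewrite scaler_sumr -big_split; apply: eq_bigr => j _ /=.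
by rewrite dsumE linearP.
Qed.

Let upper_triangular_is_bounded :
  exists M : K, forall x, `|upper_triangular_fun x| <= M * `|x|.
Proof.
have coordB (i : 'I_n) : exists M : K, forall x, `|upper_triangular_fun x i| <= M * `|x|.
  have [MD MD0 MDP] := bop_bounded_ge0 (D i).
  have /choice[MA MAP] : forall j : {j : 'I_n | (i < j)%N}, exists M : K,
      0 <= M /\ forall x, `|A (valP j) x| <= M * `|x|.
    by move=> j; have [M M0 MP] := bop_bounded_ge0 (A (valP j)); exists M.
  exists (MD + \sum_j MA j) => x.
  rewrite (le_trans (ler_normD _ _))// mulrDl lerD//.
    by rewrite (le_trans (MDP _))// ler_wpM2l// ler_dsum_coord.
  rewrite mulr_suml (le_trans (ler_norm_sum _ _ _))//; apply: ler_sum => j _.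
  by have [M0 MP] := MAP j; rewrite (le_trans (MP _))// ler_wpM2l// ler_dsum_coord.
have [M MP] := choice coordB.
exists (\sum_i M i) => x; rewrite dsum_normE mulr_suml.
by apply: ler_sum => i _; exact: MP.
Qed.

HB.instance Definition _ := GRing.isLinear.Build K (dsum X) (dsum X) *:%R
  upper_triangular_fun upper_triangular_is_linear.

Definition upper_triangular : boundedOp (dsum X) (dsum X) :=
  BoundedOp upper_triangular_is_bounded.

End UpperTriangular.

(* Main.v *)
From HB Require Import structures.
Require Import Defs.
From mathcomp Require Import all_boot all_order all_algebra.
From mathcomp Require Import complex ring lra.
From mathcomp Require Import boolp classical_sets functions filter reals topology.
From mathcomp Require Import normedtype.

(* All D_i turn out to be inner regular, hence X_i = R(D_i) (+) K_i. For
   (i) => (ii), take A bidiagonal, with A_{i,i+1} the composite of a projection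
   of X_{i+1} onto N(D_{i+1}) with an isomorphism N(D_{i+1}) -> K_i: then T is
   bijective, and its inverse is bounded by the open mapping theorem.

   For (ii) => (iii), let S be the inverse of T and P_i a bounded projection onto
   N(D_i). It is enough to find bounded surjections onto N(D_i) and K_i, for then
   the quotient by the range is zero. Back substitution along the diagonal writes
   any y supported on the coordinates < i as T u + k with u supported on the same
   coordinates and k_s in K_s. For x in N(D_i), y = T(x e_i) is of this form, so
   x e_i = u + S k, and k |-> P_i (S k)_i maps the sum of the K_s, s < i, onto
   N(D_i). For K_i, put D_s' for a generalized inverse of D_s and let V be the
   inverse of the unipotent triangular operator with entries D_s' A_{st}. If
   k in K_i and x = S(k e_i), then (T x)_s = 0 for s > i says that x_s is the s-th
   coordinate of V applied to the vector w of the P_s x_s, s > i. The projection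
   onto K_i along R(D_i) maps (T V w)_i to k, and is thus the required surjection
   in the variable w. *)

Set Implicit Arguments.
Unset Strict Implicit.
Unset Printing Implicit Defensive.

Import Order.TTheory GRing.Theory Num.Theory.
Import numFieldNormedType.Exports.

Local Open Scope classical_set_scope.
Local Open Scope ring_scope.
Local Open Scope complex_scope.

(** * Real-valued norms and nested balls *)

Section RealNorm.
Variable R : realType.
Implicit Type X : completeNormedModType R[i].

(** Norms are elements of [R[i]], whose order is partial. They are nonnegative reals, so the real
    part loses nothing and gives access to the total order of [R]. *)
Definition rnorm X (x : X) : R := complex.Re `|x|.

Lemma rnormE X (x : X) : `|x| = (rnorm x)%:C.
Proof. by rewrite /rnorm RRe_real// ger0_real. Qed.

Lemma normr_le_rnorm X (x : X) (a : R) : (`|x| <= a%:C) = (rnorm x <= a).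
Proof. by rewrite rnormE lecR. Qed.

Lemma normr_lt_rnorm X (x : X) (a : R) : (`|x| < a%:C) = (rnorm x < a).
Proof. by rewrite rnormE ltcR. Qed.

Lemma rnorm_ge0 X (x : X) : 0 <= rnorm x.
Proof. by rewrite -lecR -rnormE normr_ge0. Qed.

Lemma rnorm0 X : rnorm (0 : X) = 0.
Proof. by rewrite /rnorm normr0. Qed.

Lemma rnorm_eq0 X (x : X) : rnorm x = 0 -> x = 0.
Proof. by move=> x0; apply: normr0_eq0; rewrite rnormE x0. Qed.

Lemma rnormN X (x : X) : rnorm (- x) = rnorm x.
Proof. by rewrite /rnorm normrN. Qed.

Lemma rnorm_dist X (x y : X) : rnorm (x - y) = rnorm (y - x).
Proof. by rewrite -rnormN opprB. Qed.

Lemma rnormD X (x y : X) : rnorm (x + y) <= rnorm x + rnorm y.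
Proof. by rewrite -normr_le_rnorm rmorphD /= -!rnormE ler_normD. Qed.

Lemma rnorm_distD X (y x z : X) : rnorm (x - z) <= rnorm (x - y) + rnorm (y - z).
Proof. by rewrite -[x - z](subrKA y) rnormD. Qed.

Lemma rnormZ X (a : R) (x : X) : rnorm (a%:C *: x) = `|a| * rnorm x.
Proof.
by apply: complexI; rewrite -rnormE normrZ rnormE rmorphM/= normc_def/= expr0n/=
  addr0 sqrtr_sqr.
Qed.

Lemma rnorm_bound X Y (T : boundedOp X Y) :
  exists2 M : R, 0 <= M & forall x, rnorm (T x) <= M * rnorm x.
Proof.
have [M M0 TM] := bop_bounded_ge0 T; exists (complex.Re M).
  by move: M0; rewrite lecE => /andP[].
move=> x; rewrite -normr_le_rnorm rmorphM/= -rnormE RRe_real//.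
exact: ger0_real.
Qed.

Lemma half_pow_lt (c e : R) : 0 < e -> exists n, c / 2 ^+ n < e.
Proof.
move=> e0; have [n] : exists n : nat, c / e < n%:R.
  exists (Num.truncn (c / e)).+1; exact: truncnS_gt.
move=> cn; exists n; rewrite ltr_pdivrMr ?exprn_gt0// mulrC -ltr_pdivrMr//.
apply: (lt_trans cn); rewrite -natrX ltr_nat; exact: ltn_expl.
Qed.

(** Each closed ball of centre [u n] and radius [r n] contains the next, and the radii at least
    halve. The centres are thus Cauchy, and [l] is their limit. *)
Lemma nested_balls X (u : nat -> X) (r : nat -> R) :
  (forall n, rnorm (u n.+1 - u n) + r n.+1 <= r n) ->
  (forall n, 0 <= r n) -> (forall n, r n.+1 <= r n / 2) ->
  exists l, forall n, rnorm (l - u n) <= r n.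
Proof.
move=> ur r0 r2.
have rn n : r n <= r 0%N / 2 ^+ n.
  elim: n => [|n IH]; first by rewrite expr0 divr1.
  by rewrite exprSr invfM mulrA (le_trans (r2 n))// ler_wpM2r// invr_ge0.
(* Keeping the radius on the left makes the induction on [m] telescope. *)
have urD n m : rnorm (u (n + m)%N - u n) + r (n + m)%N <= r n.
  elim: m => [|m IH]; first by rewrite addn0 subrr rnorm0 add0r.
  rewrite addnS; have := rnorm_distD (u (n + m)%N) (u (n + m).+1) (u n).
  have := ur (n + m)%N; lra.
have unear n m : (n <= m)%N -> rnorm (u m - u n) <= r n.
  by move=> /subnKC <-; have := urD n (m - n)%N; have := r0 (n + (m - n))%N; lra.
have : cvg (u @ \oo).
  apply: cauchy_cvg; apply: cauchy_exP => e e0.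
  have e0' : 0 < complex.Re e by move: e0; rewrite ltcE => /andP[].
  have eE : e = (complex.Re e)%:C by rewrite RRe_real// gtr0_real.
  have [n rne] := half_pow_lt (r 0%N) e0'.
  exists (u n); exists n => // m /= nm.
  rewrite -ball_normE/= eE normr_lt_rnorm rnorm_dist.
  by apply: le_lt_trans rne; rewrite (le_trans (unear _ _ nm)).
move=> /cvg_ex[l ul]; exists l => n; apply/ler_addgt0Pr => e e0.
have eC0 : 0 < e%:C by rewrite ltcR.
move/cvgrPdist_lt : ul => /(_ _ eC0)[m _ /(_ (maxn n m) (leq_maxr _ _))] /=.
rewrite normr_lt_rnorm => h.
by have := rnorm_distD (u (maxn n m)) l (u n); have := unear _ _ (leq_maxl n m); lra.
Qed.

End RealNorm.

(** * The open mapping theorem and bounded inverses *)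

Section OpenMapping.
Variables (R : realType) (X Y : completeNormedModType R[i]) (T : boundedOp X Y).
Hypothesis T_surj : forall y, exists x, T x = y.

(* Baire category argument: otherwise nested balls avoid, one after the other,
   the images of the balls of radius n, and their common point is not in the
   range. *)
Lemma range_somewhere_dense : exists (n : nat) (y0 : Y) (r : R), 0 < r /\
  forall y, rnorm (y - y0) < r -> forall e, 0 < e ->
    exists2 x, rnorm x <= n%:R & rnorm (y - T x) < e.
Proof.
apply: contrapT => nH.
(* Pairs are a centre and a radius: [q] is a ball inside [p], of at most half its radius, that
   misses the image of the ball of radius [n]. The guard [0 < p.2] lets [choice] apply to all
   pairs. *)
pose good n (p q : Y * R) := 0 < p.2 ->
  [/\ 0 < q.2, q.2 <= p.2 / 2, rnorm (q.1 - p.1) + q.2 <= p.2 &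
      forall x, rnorm x <= n%:R -> q.2 < rnorm (q.1 - T x)].
have step (np : nat * (Y * R)) : exists q, good np.1 np.2 q.
  case: np => n [y0 r] /=; apply: contrapT => nq; apply: nq.
  have [r0|r0] := ltP 0 r; last by exists (y0, r); rewrite /good/= ltNge r0.
  (* If no ball follows [(y0, r)], the images are dense in the ball of radius [r / 2] about [y0]: a
     point [y] at distance at least [e] from them would be the centre of a successor. *)
  apply: contrapT => nq; apply: nH; exists n, y0, (r / 2); split.
    by rewrite divr_gt0.
  move=> y yy0 e e0; apply: contrapT => nx; apply: nq.
  exists (y, Num.min (r / 2) (e / 2)) => _ /=.
  have e20 : 0 < e / 2 by rewrite divr_gt0.
  have r20 : 0 < r / 2 by rewrite divr_gt0.
  split; rewrite ?ge_min ?lt_min ?lexx ?e20 ?r20//.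
    rewrite {2}(splitr r) lerD//; first exact: ltW.
    by rewrite ge_min lexx.
  move=> x xn; rewrite gt_min; apply/orP; right.
  apply: (@lt_le_trans _ _ e); first by lra.
  by rewrite leNgt; apply/negP => ?; apply: nx; exists x.
have [f fP] := choice step.
pose p := fix p n := if n is m.+1 then f (m, p m) else (0 : Y, 1 : R).
have p0 n : 0 < (p n).2.
  by elim: n => [|n IH] /=; [exact: ltr01|case: (fP (n, p n) IH)].
have [l lP] : exists l, forall n, rnorm (l - (p n).1) <= (p n).2.
  apply: nested_balls => n.
  - by case: (fP (n, p n) (p0 n)).
  - exact: ltW.
  - by case: (fP (n, p n) (p0 n)).
have [x xl] := T_surj l.
pose n := (Num.truncn (rnorm x)).+1.
have [_ _ _ /(_ x)] := fP (n, p n) (p0 n).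
rewrite xl rnorm_dist => /(_ (ltW (truncnS_gt _))).
by rewrite ltNge (lP n.+1).
Qed.

(** Scaled by [a] to norm [r / 2], [y] is the difference of two points of the ball where the images
    are dense. Subtracting their approximate preimages leaves an error of at most [r / 8 + r / 8],
    half that norm, with a vector of norm at most [2 * n]; undoing the scaling gives [4 * n / r]. *)
Lemma approx_preimage : exists2 C : R, 0 <= C & forall y, exists x,
  rnorm x <= C * rnorm y /\ rnorm (y - T x) <= rnorm y / 2.
Proof.
have [n [y0 [r [r0 H]]]] := range_somewhere_dense.
have r80 : 0 < r / 8 by rewrite divr_gt0.
exists (4 * n%:R / r); first by rewrite divr_ge0 ?mulr_ge0// ltW.
move=> y; have [->|y_neq0] := eqVneq y 0.
  by exists 0; rewrite linear0 subrr !rnorm0 mulr0 mul0r.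
have y_gt0 : 0 < rnorm y.
  rewrite lt_neqAle rnorm_ge0 andbT eq_sym; apply: contra_neq y_neq0.
  exact: rnorm_eq0.
pose a := r / 2 / rnorm y.
have a0 : 0 < a by rewrite !divr_gt0.
have az : rnorm (a%:C *: y) = r / 2.
  by rewrite rnormZ gtr0_norm// /a divfK// gt_eqF.
have [x1 x1n x1y] : exists2 x, rnorm x <= n%:R & rnorm (y0 + a%:C *: y - T x) < r / 8.
  by apply: H => //; rewrite addrAC subrr add0r az; lra.
have [x2 x2n x2y] : exists2 x, rnorm x <= n%:R & rnorm (y0 - T x) < r / 8.
  by apply: H => //; rewrite subrr rnorm0.
exists ((a^-1)%:C *: (x1 - x2)).
have aV : a^-1 = 2 / r * rnorm y by rewrite /a !invfM !invrK; ring.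
have aV0 : 0 <= a^-1 by rewrite invr_ge0 ltW.
split.
  rewrite rnormZ (ger0_norm aV0) aV.
  have := rnormD x1 (- x2); rewrite rnormN => x12.
  have -> : 4 * n%:R / r * rnorm y = 2 / r * rnorm y * (n%:R + n%:R) by field; rewrite gt_eqF.
  by rewrite ler_wpM2l -?aV//; lra.
have -> : y - T ((a^-1)%:C *: (x1 - x2)) =
    (a^-1)%:C *: ((y0 + a%:C *: y - T x1) - (y0 - T x2)).
  have -> : y0 + a%:C *: y - T x1 - (y0 - T x2) = a%:C *: y - (T x1 - T x2).
    by rewrite opprB (addrC y0) addrAC (addrC (T x2)) addrA addrK opprB addrA addrAC.
  rewrite linearZ linearB [RHS]scalerBr scalerA -rmorphM/= mulVf ?gt_eqF//.
  by rewrite rmorph1 scale1r.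
rewrite rnormZ (ger0_norm aV0) aV.
have := rnormD (y0 + a%:C *: y - T x1) (- (y0 - T x2)); rewrite rnormN => x12.
have -> : rnorm y / 2 = 2 / r * rnorm y * (r / 8 + r / 8) by field; rewrite gt_eqF.
by rewrite ler_wpM2l -?aV//; lra.
Qed.

(** Approximate preimages of the successive residuals are summed; each residual is at most half the
    previous one, and completeness provides the sum [x]. *)
Lemma open_mapping : exists2 C : R, 0 <= C & forall y, exists2 x,
  T x = y & rnorm x <= C * rnorm y.
Proof.
have [C C0 /choice[g gP]] := approx_preimage; exists (2 * C); first by lra.
have [M M0 TM] := rnorm_bound T.
move=> y; pose res := fix res n := if n is m.+1 then res m - T (g (res m)) else y.
have resn n : rnorm (res n) <= rnorm y / 2 ^+ n.
  elim: n => [|n IH] /=; first by rewrite expr0 divr1.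
  have [_ h] := gP (res n); rewrite (le_trans h)// exprSr invfM mulrA.
  by rewrite ler_wpM2r// invr_ge0.
pose u n := \sum_(k < n) g (res k).
have Tu n : T (u n) = y - res n.
  rewrite /u; elim: n => [|n IH]; first by rewrite big_ord0 linear0 subrr.
  by rewrite big_ord_recr/= linearD IH; rewrite opprB addrA addrAC.
have pow0 n : 0 <= rnorm y / 2 ^+ n by rewrite divr_ge0 ?rnorm_ge0// exprn_ge0.
have powS n : rnorm y / 2 ^+ n.+1 = rnorm y / 2 ^+ n / 2.
  by rewrite exprSr invfM mulrA.
(* The radius is the geometric tail of the bounds [C * (rnorm y / 2 ^+ k)], [k >= n]; at [n = 0] it
   bounds [x] itself. *)
have [x xu] : exists x, forall n, rnorm (x - u n) <= 2 * C * (rnorm y / 2 ^+ n).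
  apply: nested_balls => n.
  - rewrite /u big_ord_recr/= addrAC subrr add0r powS.
    have [h _] := gP (res n); have := ler_wpM2l C0 (resn n).
    by have := pow0 n; nra.
  - by rewrite mulr_ge0//; lra.
  - by rewrite powS mulrA.
exists x; last by have := xu 0%N; rewrite /u big_ord0 subr0 expr0 divr1.
apply/eqP; rewrite -subr_eq0; apply/eqP/rnorm_eq0/eqP.
rewrite eq_le rnorm_ge0 andbT; apply/ler_addgt0Pr => e e0; rewrite add0r.
(* The constant comes from [T x - y = T (x - u n) - res n], where both terms decay like
   [1 / 2 ^+ n]. *)
have [n ne] := half_pow_lt ((1 + M * (2 * C)) * rnorm y) e0.
apply/ltW; apply: le_lt_trans ne.
have := rnormD (T (x - u n)) (- res n); rewrite rnormN linearB Tu.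
have -> : T x - (y - res n) - res n = T x - y by rewrite opprB addrA addrAC addrK.
have := TM (x - u n); have := ler_wpM2l M0 (xu n); have := resn n.
rewrite linearB Tu -mulrA mulrDl; lra.
Qed.

(** The preimages are chosen with the open mapping bound, and injectivity makes the choice
    linear. *)
Lemma bijective_invertible : (forall x, T x = 0 -> x = 0) -> invertible T.
Proof.
move=> T_inj; have [C C0 T_open] := open_mapping.
have /choice[g gP] : forall y, exists x, T x = y /\ rnorm x <= C * rnorm y.
  by move=> y; have [x] := T_open y; exists x.
have T_eq x x' : T x = T x' -> x = x'.
  by move=> xx'; apply/eqP; rewrite -subr_eq0; apply/eqP/T_inj; rewrite linearB xx' subrr.
have g_linear : linear g.
  move=> a y z; apply: T_eq; rewrite linearP.
  by rewrite (gP (a *: y + z)).1 (gP y).1 (gP z).1.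
pose gL := GRing.isLinear.Build _ _ _ _ g g_linear.
pose gl : {linear Y -> X} := HB.pack g gL.
have g_bounded : exists M : R[i], forall y, `|gl y| <= M * `|y|.
  exists C%:C => y; rewrite (rnormE y) -rmorphM/= normr_le_rnorm.
  exact: (gP y).2.
pose S := BoundedOp g_bounded.
split; exists S; last by move=> y; exact: (gP y).1.
by move=> x; apply: T_eq; exact: (gP (T x)).1.
Qed.

End OpenMapping.

(** * Elementary constructions of bounded operators *)

Section Operators.
Context {K : numFieldType}.
Implicit Types X Y Z : completeNormedModType K.

Definition bop_of X Y (f : X -> Y) (f_linear : linear f)
    (f_bounded : exists M : K, forall x, `|f x| <= M * `|x|) : boundedOp X Y :=
  BoundedOp (bop_linear := HB.pack f (GRing.isLinear.Build _ _ _ _ f f_linear))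
    f_bounded.

Fact bop_id_linear X : linear (@idfun X).
Proof. by []. Qed.

Fact bop_id_bounded X : exists M : K, forall x : X, `|idfun x| <= M * `|x|.
Proof. by exists 1 => x; rewrite mul1r. Qed.

Definition bop_id X := bop_of (@bop_id_linear X) (@bop_id_bounded X).

Section Comp.
Variables (X Y Z : completeNormedModType K) (S : boundedOp Y Z) (T : boundedOp X Y).

Fact bop_comp_linear : linear (S \o T).
Proof. by move=> a x y /=; rewrite !linearP. Qed.

Fact bop_comp_bounded : exists M : K, forall x, `|(S \o T) x| <= M * `|x|.
Proof.
have [M M0 SM] := bop_bounded_ge0 S; have [N TN] := bop_bounded T.
by exists (M * N) => x; rewrite -mulrA (le_trans (SM _))// ler_wpM2l.
Qed.

Definition bop_comp := bop_of bop_comp_linear bop_comp_bounded.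
End Comp.

Section Sub.
Variables (X Y : completeNormedModType K) (S T : boundedOp X Y).

Fact bop_sub_linear : linear (fun x => S x - T x).
Proof. by move=> a x y /=; rewrite (linearP S) (linearP T) opprD addrACA scalerBr. Qed.

Fact bop_sub_bounded : exists M : K, forall x, `|S x - T x| <= M * `|x|.
Proof.
have [M SM] := bop_bounded S; have [N TN] := bop_bounded T.
by exists (M + N) => x; rewrite mulrDl (le_trans (ler_normB _ _))// lerD.
Qed.

Definition bop_sub := bop_of bop_sub_linear bop_sub_bounded.
End Sub.

Section Sum.
Variables (X Y : completeNormedModType K) (I : finType) (T : I -> boundedOp X Y).

Fact bop_sum_linear : linear (fun x => \sum_i T i x).
Proof.
move=> a x y /=; rewrite scaler_sumr -big_split; apply: eq_bigr => i _.
by rewrite linearP.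
Qed.

Fact bop_sum_bounded : exists M : K, forall x, `|\sum_i T i x| <= M * `|x|.
Proof.
have /choice[M TM] : forall i, exists M : K, forall x, `|T i x| <= M * `|x|.
  by move=> i; exact: bop_bounded.
exists (\sum_i M i) => x; rewrite mulr_suml (le_trans (ler_norm_sum _ _ _))//.
by apply: ler_sum => i _; exact: TM.
Qed.

Definition bop_sum := bop_of bop_sum_linear bop_sum_bounded.
End Sum.

Section Subspace.
Variables (X Y : completeNormedModType K) (S : closedSubspace Y).

Fact bop_incl_linear : linear (val : S -> Y).
Proof. by []. Qed.

Fact bop_incl_bounded : exists M : K, forall x : S, `|val x| <= M * `|x|.
Proof. by exists 1 => x; rewrite mul1r. Qed.

Definition bop_incl := bop_of bop_incl_linear bop_incl_bounded.

Variables (T : boundedOp X Y) (TS : forall x, cs_set S (T x)).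

Definition corestr_fun (x : X) : S := exist _ (T x) (mem_set (TS x)).

Fact corestr_linear : linear corestr_fun.
Proof. by move=> a x y; apply: val_inj; rewrite /= linearP. Qed.

Fact corestr_bounded : exists M : K, forall x, `|corestr_fun x| <= M * `|x|.
Proof. exact: bop_bounded. Qed.

Definition bop_corestr := bop_of corestr_linear corestr_bounded.
End Subspace.

Section Coordinates.
Variables (I : finType) (X : I -> completeNormedModType K).

Fact bop_coord_linear i : linear (fun x : dsum X => x i).
Proof. by []. Qed.

Fact bop_coord_bounded i : exists M : K, forall x : dsum X, `|x i| <= M * `|x|.
Proof. by exists 1 => x; rewrite mul1r ler_dsum_coord. Qed.

Definition bop_coord i := bop_of (@bop_coord_linear i) (@bop_coord_bounded i).

Definition inj_fun i (x : X i) : dsum X := @dfwith I X (fun=> 0) i x.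

Fact inj_linear i : linear (@inj_fun i).
Proof.
move=> a x y; apply: functional_extensionality_dep => j.
have dsumE (u v : dsum X) : (a *: u + v) j = a *: u j + v j by [].
rewrite dsumE /inj_fun; case: dfwithP => [|j' ij']; first by rewrite !dfwith_in.
by rewrite !dfwith_out// scaler0 addr0.
Qed.

Fact inj_bounded i : exists M : K, forall x : X i, `|inj_fun x| <= M * `|x|.
Proof.
exists 1 => x; rewrite mul1r dsum_normE (bigD1 i)//= /inj_fun dfwith_in big1 ?addr0//.
by move=> j ji; rewrite dfwith_out ?normr0// eq_sym.
Qed.

Definition bop_inj i := bop_of (@inj_linear i) (@inj_bounded i).

Lemma bop_inj_in i (x : X i) : bop_inj i x i = x.
Proof. exact: dfwith_in. Qed.

Lemma bop_inj_out i j (x : X i) : i != j -> bop_inj i x j = 0.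
Proof. exact: dfwith_out. Qed.

End Coordinates.

Lemma dsum_addE (I : finType) (X : I -> completeNormedModType K) (x y : dsum X) i :
  (x + y) i = x i + y i.
Proof. by []. Qed.

Lemma dsum_subE (I : finType) (X : I -> completeNormedModType K) (x y : dsum X) i :
  (x - y) i = x i - y i.
Proof. by []. Qed.

Lemma dsum_sumE (I J : finType) (X : I -> completeNormedModType K) (x : J -> dsum X) i :
  (\sum_j x j) i = \sum_j x j i.
Proof. exact: (raddf_sum (bop_coord X i)). Qed.

End Operators.

(** * Direct sums of subspaces over part of the coordinates *)

Section PartialSum.
Context {K : numFieldType}.
Variables (I : finType) (X : I -> completeNormedModType K).
Variables (p : pred I) (S : forall i, closedSubspace (X i)).

(** Extension by zero outside [p], written as a sum of compositions so that linearity and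
    boundedness are inherited. *)
Definition bop_embed :
    boundedOp (dsum (fun t : {i : I | p i} => S (val t))) (dsum X) :=
  bop_sum (fun t : {i : I | p i} => bop_comp (bop_inj X (val t))
    (bop_comp (bop_incl (S (val t))) (bop_coord _ t))).

Lemma bop_embedE w i :
  bop_embed w i = \sum_(t : {i : I | p i}) bop_inj X (val t) (val (w t)) i.
Proof. exact: dsum_sumE. Qed.

Lemma bop_embed_in w (t : {i : I | p i}) : bop_embed w (val t) = val (w t).
Proof.
rewrite bop_embedE (bigD1 t)// bop_inj_in big1 => [|t' t't].
  exact: addr0.
by apply: bop_inj_out; rewrite val_eqE.
Qed.

Lemma bop_embed_out w i : ~~ p i -> bop_embed w i = 0.
Proof.
move=> pi; rewrite bop_embedE big1// => t _; rewrite bop_inj_out//.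
by apply: contraNneq pi => <-; exact: (valP t).
Qed.

Lemma bop_embed_onto (x : dsum X) :
  (forall i, p i -> cs_set (S i) (x i)) -> (forall i, ~~ p i -> x i = 0) ->
  exists w, bop_embed w = x.
Proof.
move=> xS x0.
exists (fun t : {i : I | p i} =>
  exist _ (x (val t)) (mem_set (xS (val t) (valP t))) : S (val t)).
apply: functional_extensionality_dep => i.
have [pi|pi] := boolP (p i); last by rewrite bop_embed_out// x0.
by rewrite (bop_embed_in _ (exist _ i pi)).
Qed.

End PartialSum.

(** * Generalized inverses, complements and projections *)

Section InnerRegular.
Context {K : numFieldType}.
Variables (X : completeNormedModType K) (T T' : boundedOp X X).
Hypothesis TT'T : forall x, T (T' (T x)) = T x.

(** [T T'] is idempotent with the same range as [T]. Being the kernel of [I - T T'], this range is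
    closed. *)
Lemma range_ker y : range T y <-> cs_set (ker (bop_sub (bop_id X) (bop_comp T T'))) y.
Proof.
split; first by case=> x _ <-; rewrite /= TT'T subrr.
by move=> /subr0_eq/= yE; exists (T' y).
Qed.

Lemma closure_range_range y : cs_set (closure_range T) y -> exists x, T x = y.
Proof.
move=> Ty; suff [x _ <-] : range T y by exists x.
apply/range_ker.
rewrite [X in X y](closure_id _).1; last exact: cs_closed.
by move: Ty; apply: closureS => z /range_ker.
Qed.

(** The complement is the kernel of the projection [T T'] onto the range. *)
Lemma inner_regular_complemented : complemented (closure_range T).
Proof.
exists (ker (bop_comp T T')); split.
  move=> y; exists (T (T' y)), (y - T (T' y)); split.
  - by apply: subset_closure; exists (T' y).
  - by rewrite /= linearB linearB /= TT'T subrr.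
  - by rewrite addrC subrK.
apply/seteqP; split => [y [/closure_range_range[x <-]] /=|_ ->].
  by rewrite TT'T.
by split; exact: cs_zero.
Qed.

Fact ker_projection_ker x :
  cs_set (ker T) (bop_sub (bop_id X) (bop_comp T' T) x).
Proof. by rewrite /= linearB/= TT'T subrr. Qed.

Definition ker_projection : boundedOp X (ker T) := bop_corestr ker_projection_ker.

Lemma ker_projectionE x : val (ker_projection x) = x - T' (T x).
Proof. by []. Qed.

Lemma ker_projection_id x : T x = 0 -> val (ker_projection x) = x.
Proof. by move=> x0; rewrite ker_projectionE x0 linear0 subr0. Qed.

Lemma op_ker_projection x : T (val (ker_projection x)) = 0.
Proof. exact: ker_projection_ker. Qed.

End InnerRegular.

Lemma left_invertible_inner_regular (K : numFieldType) (X : completeNormedModType K)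
  (T : boundedOp X X) : left_invertible T -> inner_regular T.
Proof. by move=> [S ST]; exists S => x; rewrite ST. Qed.

Lemma right_invertible_inner_regular (K : numFieldType) (X : completeNormedModType K)
  (T : boundedOp X X) : right_invertible T -> inner_regular T.
Proof. by move=> [S TS]; exists S => x; rewrite TS. Qed.

(* The sum map from the direct sum of M and L to X is a bounded bijection. *)
Lemma complement_projection (R : realType) (X : completeNormedModType R[i])
    (M L : closedSubspace X) : topological_complement M L ->
  exists Q : boundedOp X L, (forall x, cs_set M x -> Q x = 0) /\
    (forall x, cs_set L x -> val (Q x) = x).
Proof.
move=> [ML MIL]; pose F b := if b then M else L.
pose T : boundedOp (dsum (fun b : bool => F b)) X :=
  bop_sum (fun b => bop_comp (bop_incl (F b)) (bop_coord _ b)).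
have TE w : T w = val (w true) + val (w false) by rewrite /T /= big_bool.
have FS b (x : F b) : cs_set (F b) (val x) by exact: set_mem (valP x).
have T_inj w : T w = 0 -> w = 0.
  rewrite TE => w0.
  have w1E : val (w true) = - val (w false) by apply/eqP; rewrite -addr_eq0 w0.
  have : (M `&` L) (val (w true)).
    split; first exact: (FS true).
    by rewrite w1E -scaleN1r -[_ *: _]addr0; apply: cs_linear; [exact: (FS false)|exact: cs_zero].
  rewrite MIL => w10; have w20 : val (w false) = 0.
    by move: w0; rewrite [val (w true)]w10 add0r.
  by apply: functional_extensionality_dep => -[]; exact: val_inj.
have T_surj x : exists w, T w = x.
  have [u [v [Mu Lv ->]]] := ML x.
  exists (fun b => if b return F b then exist _ u (mem_set Mu) : M
    else exist _ v (mem_set Lv) : L).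
  by rewrite TE.
have [[S ST] _] := bijective_invertible T_surj T_inj.
exists (bop_comp (bop_coord _ false) S); split=> x Sx.
  suff -> : x = T (bop_inj (fun b => F b) true (exist _ x (mem_set Sx) : M)).
    by rewrite /= ST; apply: bop_inj_out.
  by rewrite TE bop_inj_in bop_inj_out// addr0.
suff {1}-> : x = T (bop_inj (fun b => F b) false (exist _ x (mem_set Sx) : L)).
  by rewrite /= ST [X in val X](@bop_inj_in _ _ (fun b => F b) false).
by rewrite TE bop_inj_in bop_inj_out// add0r.
Qed.

(** * Back substitution in upper triangular systems *)

Section UpperTriangularSolve.
Context {K : numFieldType}.
Variables (n : nat) (X : 'I_n -> completeNormedModType K).
Variables (D : forall i, boundedOp (X i) (X i)) (A : strictly_upper X).
Let T := upper_triangular D A.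

Lemma upper_triangular_last (x : dsum X) (i : 'I_n) :
  (forall j : 'I_n, (i < j)%N -> x j = 0) -> T x i = D i (x i).
Proof.
move=> x0; rewrite /T /= /upper_triangular_fun big1 ?addr0// => j _.
by rewrite x0 ?linear0//; exact: (valP j).
Qed.

(** Downward induction on [i], run on [n - i]: once the later coordinates vanish, row [i] reduces to
    its diagonal term. *)
Lemma upper_triangular_tail0 (m : nat) (x : dsum X) :
  (forall i : 'I_n, (m <= i)%N -> forall y, D i y = 0 -> y = 0) ->
  (forall i : 'I_n, (m <= i)%N -> T x i = 0) ->
  forall i : 'I_n, (m <= i)%N -> x i = 0.
Proof.
move=> D_inj Tx0 i; have [k] := ubnP (n - i); elim: k i => // k IH i ik mi.
apply: D_inj => //; rewrite -upper_triangular_last ?Tx0// => j ij.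
apply: IH; last exact: leq_trans mi (ltnW ij).
by rewrite -ltnS (leq_trans _ ik)// ltnS ltn_sub2l.
Qed.

(** The rows are solved from the last to the first. Correcting coordinate [n - m.+1] does not affect
    the later rows, which are already solved. *)
Lemma upper_triangular_surj :
  (forall i y, exists x, D i x = y) -> forall y, exists x, T x = y.
Proof.
move=> D_surj y.
suff H m : (m <= n)%N -> exists x, forall i : 'I_n, (n - m <= i)%N -> T x i = y i.
  have [x xy] := H n (leqnn n); exists x.
  by apply: functional_extensionality_dep => i; rewrite xy// subnn.
elim: m => [_|m IH mn].
  by exists 0 => i; rewrite subn0 leqNgt ltn_ord.
have [x xP] := IH (ltnW mn).
have inm : (n - m.+1 < n)%N by rewrite ltn_subrL/= (leq_ltn_trans _ mn).
pose i := Ordinal inm; have [u Du] := D_surj i (y i - T x i).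
exists (x + bop_inj X i u) => j; rewrite linearD dsum_addE leq_eqVlt => /orP[ij|ij].
  have -> : j = i by apply: val_inj; apply/esym/eqP.
  rewrite (@upper_triangular_last (bop_inj X i u)) => [|k ik].
    by rewrite bop_inj_in Du addrC subrK.
  by rewrite bop_inj_out// -val_eqE ltn_eqF.
rewrite (@upper_triangular_last (bop_inj X i u)) => [|k jk].
  rewrite bop_inj_out ?linear0 ?addr0; last by rewrite -val_eqE ltn_eqF.
  by apply: xP; rewrite -(subnSK mn).
by rewrite bop_inj_out// -val_eqE ltn_eqF// (ltn_trans ij).
Qed.

(** Decompose the last possibly nonzero coordinate of [y] as [D i u + v]. Subtracting
    [T (u e_i) + v e_i] clears it and otherwise changes only earlier rows, so induction on [m]
    applies to the rest. *)
Lemma upper_triangular_decomposition (S : forall i, closedSubspace (X i)) (m : nat) :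
  (m <= n)%N ->
  (forall (i : 'I_n) y, (i < m)%N -> exists u v, cs_set (S i) v /\ y = D i u + v) ->
  forall y : dsum X, (forall i : 'I_n, (m <= i)%N -> y i = 0) ->
  exists u v : dsum X, [/\ forall i, cs_set (S i) (v i),
    forall i : 'I_n, (m <= i)%N -> u i = 0 /\ v i = 0 & y = T u + v].
Proof.
elim: m => [_ _|m IH mn DS] y y0.
  exists 0, 0; split => //; first by move=> i; exact: cs_zero.
  by rewrite linear0 addr0; apply: functional_extensionality_dep => i; rewrite y0.
pose i := Ordinal mn; have [u [v [Sv yE]]] := DS i (y i) (ltnSn m).
have z0 (j : 'I_n) : (m <= j)%N -> (y - (T (bop_inj X i u) + bop_inj X i v)) j = 0.
  rewrite dsum_subE dsum_addE leq_eqVlt => /orP[ij|ij].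
    have -> : j = i by apply: val_inj; apply/esym/eqP.
    rewrite upper_triangular_last => [|k ik].
      by rewrite !bop_inj_in yE subrr.
    by rewrite bop_inj_out// -val_eqE ltn_eqF.
  rewrite upper_triangular_last => [|k jk].
    by rewrite y0// !bop_inj_out ?linear0 ?addr0 ?subr0// -val_eqE ltn_eqF.
  by rewrite bop_inj_out// -val_eqE ltn_eqF// (ltn_trans ij).
have [|u' [v' [Sv' uv'0 zE]]] := IH (ltnW mn) _ _ z0.
  by move=> j w jm; apply: DS; exact: ltnW.
exists (u' + bop_inj X i u), (v' + bop_inj X i v); split.
- move=> j; rewrite dsum_addE -[v' j]scale1r; apply: cs_linear => //.
  rewrite /bop_inj/= /inj_fun; case: eqtype.dfwithP => // k _; exact: cs_zero.
- move=> j mj; have [u'0 v'0] := uv'0 j (ltnW mj).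
  by rewrite !dsum_addE u'0 v'0 !add0r !bop_inj_out// -val_eqE ltn_eqF.
- by rewrite linearD addrACA -zE subrK.
Qed.

End UpperTriangularSolve.

(** A surjection has zero cokernel, spanned by the empty family, whereas [prec] makes every cokernel
    infinite dimensional. *)
Lemma surj_not_prec (K : numFieldType) (X Y : completeNormedModType K)
  (T : boundedOp X Y) : (forall y, exists x, T x = y) -> ~ prec X Y.
Proof.
move=> T_surj [_ /(_ T)]; apply; exists [::] => v; exists (fun=> 0).
rewrite big_ord0 -[v]reprK.
(* Zero is written as the class of [0 *: 0], which turns the equality of classes into membership in
   the range. *)
rewrite -[RHS](scale0r (\pi_(coker T)%qT 0)) -quotient_moduleZ.
apply/quotient_module_eq; apply/mem_set.
by have [x <-] := T_surj (repr v - 0 *: 0); exists x.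
Qed.

Lemma dependent_fun_choice (I : Type) (F : I -> Type) (P : forall i, F i -> Prop) :
  (forall i, exists x, P i x) -> exists f : forall i, F i, forall i, P i (f i).
Proof.
by move=> H; exists (fun i => projT1 (cid (H i))) => i; exact: projT2 (cid (H i)).
Qed.

(** Identities on the diagonal make back substitution bijective; the open mapping theorem bounds the
    inverse. *)
Lemma unipotent_right_invertible (R : realType) (n : nat)
    (X : 'I_n -> completeNormedModType R[i]) (B : strictly_upper X) :
  right_invertible (upper_triangular (fun i => bop_id (X i)) B).
Proof.
have [|//|//] := @bijective_invertible _ _ _ (upper_triangular (fun i => bop_id (X i)) B).
  by apply: upper_triangular_surj => i y; exists y.
move=> x Bx0; apply: functional_extensionality_dep => i.
apply: (@upper_triangular_tail0 _ _ _ (fun i => bop_id (X i)) B 0) => // j _.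
by rewrite Bx0.
Qed.

(** * Consequences of the invertibility of an upper triangular operator *)

Section Necessity.
Context {K : numFieldType}.
Variables (n : nat) (X : 'I_n -> completeNormedModType K).
Variables (D : forall i, boundedOp (X i) (X i)) (A : strictly_upper X).
Let T := upper_triangular D A.
Variable S : boundedOp (dsum X) (dsum X).

(** The first column of [T] has only its diagonal entry, so the corner entry of [S] is a left
    inverse of it. *)
Lemma upper_triangular_first_left_invertible (i : 'I_n) :
  (forall x, S (T x) = x) -> i = 0%N :> nat -> left_invertible (D i).
Proof.
move=> ST i0; exists (bop_comp (bop_coord X i) (bop_comp S (bop_inj X i))) => x.
suff TE : T (bop_inj X i x) = bop_inj X i (D i x).
  by rewrite -[RHS](@bop_inj_in _ _ X i x) -[in RHS](ST (bop_inj X i x)) TE.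
apply: functional_extensionality_dep => j.
rewrite upper_triangular_last => [|k jk]; last first.
  by rewrite bop_inj_out// -val_eqE ltn_eqF//= i0 (leq_trans _ jk).
have [ij|ij] := eqVneq i j; first by case: j / ij; rewrite !bop_inj_in.
by rewrite !bop_inj_out// linear0.
Qed.

(** The last row of [T] has only its diagonal entry, so the corner entry of [S] is a right inverse
    of it. *)
Lemma upper_triangular_last_right_invertible (i : 'I_n) :
  (forall y, T (S y) = y) -> i.+1 = n -> right_invertible (D i).
Proof.
move=> TS ni; exists (bop_comp (bop_coord X i) (bop_comp S (bop_inj X i))) => y.
rewrite -[RHS](@bop_inj_in _ _ X i y) -[in RHS](TS (bop_inj X i y)).
rewrite upper_triangular_last// => j.
by rewrite leqNgt ltnS -ltnS ni ltn_ord.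
Qed.

Variables (D' : forall i, boundedOp (X i) (X i)).
Hypothesis DD'D : forall i x, D i (D' i (D i x)) = D i x.
Variable (L : forall i, closedSubspace (X i)).

Lemma kernel_is_image (i : 'I_n) : (forall x, S (T x) = x) ->
  (forall (s : 'I_n) y, (s < i)%N -> exists u v, cs_set (L s) v /\ y = D s u + v) ->
  exists E : boundedOp (dsum (fun s : {s : 'I_n | (s < i)%N} => L (val s)))
    (ker (D i)), forall y, exists x, E x = y.
Proof.
move=> ST DL; pose P := ker_projection (@DD'D i).
exists (bop_comp P (bop_comp (bop_coord X i) (bop_comp S
  (bop_embed (fun s : 'I_n => (s < i)%N) L)))) => y.
have Dy : D i (val y) = 0 by exact: set_mem (valP y).
(* Rows after [i] vanish by triangularity, and row [i] because [val y] is in the kernel of [D i]. *)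
have Ty0 (s : 'I_n) : (i <= s)%N -> T (bop_inj X i (val y)) s = 0.
  move=> si; rewrite upper_triangular_last => [|j sj]; last first.
    by rewrite bop_inj_out// -val_eqE ltn_eqF// (leq_ltn_trans si).
  have [is_|is_] := eqVneq i s; last by rewrite bop_inj_out// linear0.
  by case: s / is_ si => _; rewrite bop_inj_in.
have [u [v [Lv uv0 TyE]]] := upper_triangular_decomposition A (ltnW (ltn_ord i)) DL Ty0.
have [|w wE] := bop_embed_onto (p := fun s : 'I_n => (s < i)%N) (fun s _ => Lv s) (x := v).
  by move=> s; rewrite -leqNgt => /uv0[].
have Sw : S (bop_embed _ L w) = bop_inj X i (val y) - u.
  by rewrite wE -[LHS](addKr (S (T u))) -linearD -TyE !ST addrC.
exists w; apply: val_inj; apply: etrans (congr1 (fun v : dsum X => val (P (v i))) Sw) _.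
by rewrite dsum_subE bop_inj_in (uv0 i (leqnn i)).1 subr0 ker_projection_id.
Qed.

(** Unipotent invertibility is a hypothesis here because it is proved over [R[i]], while [K] is any
    [numFieldType]. *)
Lemma complement_is_image (i : 'I_n) (Q : boundedOp (X i) (L i)) :
  (forall B : strictly_upper X,
     right_invertible (upper_triangular (fun i => bop_id (X i)) B)) ->
  (forall y, T (S y) = y) ->
  (forall x, Q (D i x) = 0) -> (forall x, cs_set (L i) x -> val (Q x) = x) ->
  exists G : boundedOp (dsum (fun s : {s : 'I_n | (i < s)%N} => ker (D (val s))))
    (L i), forall y, exists x, G x = y.
Proof.
move=> unipotent_inv TS QD QL; pose B : strictly_upper X := fun s t st => bop_comp (D' s) (A st).
pose U := upper_triangular (fun i => bop_id (X i)) B.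
have [V UV] := unipotent_inv B.
exists (bop_comp Q (bop_comp (bop_coord X i) (bop_comp T (bop_comp V
  (bop_embed (fun s : 'I_n => (i < s)%N) (fun s => ker (D s))))))) => y.
pose x := S (bop_inj X i (val y)).
(* Since [T x s = 0], the off-diagonal sum of row [s] is [- D s (x s)]; applying [D' s] turns
   [U x s] into [x s - D' s (D s (x s))]. *)
have UE (s : 'I_n) : (i < s)%N -> U x s = val (ker_projection (@DD'D s) (x s)).
  move=> si; rewrite ker_projectionE.
  have : T x s = 0 by rewrite TS bop_inj_out// -val_eqE ltn_eqF.
  rewrite {1}/T /= /upper_triangular_fun => /eqP; rewrite addr_eq0 => /eqP ->.
  by rewrite /U/= /upper_triangular_fun linearN opprK linear_sum.
pose z : dsum X := fun s => if (i < s)%N then U x s else 0.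
have [||w wE] := bop_embed_onto (p := fun s : 'I_n => (i < s)%N)
    (S := fun s => ker (D s)) (x := z).
- by move=> s si; rewrite /z si UE//; exact: op_ker_projection.
- by move=> s /negbTE si; rewrite /z si.
exists w; apply: etrans (congr1 (fun v : dsum X => Q (T (V v) i)) wE) _.
(* [U] sends both [V z] and [x] to vectors that agree after [i], and back substitution recovers
   those coordinates. *)
have VU (s : 'I_n) : (i < s)%N -> (V z - x) s = 0.
  apply: (@upper_triangular_tail0 _ _ _ (fun i => bop_id (X i)) B) => // t it.
  by rewrite linearB UV dsum_subE /z it subrr.
(* In row [i] the two vectors then differ only through the diagonal term, which [Q] kills. *)
have -> : T (V z) i = T x i + D i ((V z - x) i).
  by rewrite -(@upper_triangular_last _ _ _ D A)// linearB dsum_subE addrC subrK.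
rewrite linearD QD addr0 TS bop_inj_in.
by apply: val_inj; rewrite QL//; exact: set_mem (valP y).
Qed.

End Necessity.

(** * Bijectivity of the bidiagonal completion *)

Section Sufficiency.
Context {K : numFieldType}.

(** The operator is the kernel projection followed by the isomorphism. The last property holds
    because [D x] and the kernel component of [x] can be prescribed independently. *)
Lemma connecting_operator (X Y : completeNormedModType K) (D D' : boundedOp X X)
  (L : closedSubspace Y) : (forall x, D (D' (D x)) = D x) ->
  isomorphic (ker D) L -> exists A : boundedOp X Y,
  [/\ forall x, cs_set L (A x), forall x, D x = 0 -> A x = 0 -> x = 0 &
      forall k u, cs_set L k -> exists2 x, D x = D u & A x = k].
Proof.
move=> DD'D [J [[J1 J1J] [J2 JJ2]]]; pose P := ker_projection DD'D.
exists (bop_comp (bop_incl L) (bop_comp J P)); split=> [x|x Dx Ax|k u Lk].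
- exact: set_mem (valP _).
- have JP0 : J (P x) = 0 by exact: val_inj.
  by rewrite -[x](ker_projection_id DD'D)// -[ker_projection _ _]J1J JP0 linear0.
pose v := J2 (exist _ k (mem_set Lk)).
have Dv : D (val v) = 0 by exact: set_mem (valP v).
have Dx : D (val v + u - val (P u)) = D u.
  by rewrite linearB linearD Dv add0r op_ker_projection subr0.
(* The kernel component of [u] is replaced by [v], the preimage of [k]. *)
exists (val v + u - val (P u)) => //.
suff Pv : P (val v + u - val (P u)) = v.
  by apply: etrans (congr1 (fun z => val (J z)) Pv) _; rewrite JJ2.
apply: val_inj; rewrite [val (P _)]ker_projectionE Dx.
by rewrite ker_projectionE opprB addrA addrAC !addrK.
Qed.

Section Bidiagonal.
Variables (n : nat) (X : 'I_n -> completeNormedModType K).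
Variables (D : forall i, boundedOp (X i) (X i)) (A : strictly_upper X).
Variable (L : forall i, closedSubspace (X i)).
Hypothesis DL : forall i y, exists u v, cs_set (L i) v /\ y = D i u + v.
Hypothesis DL0 : forall i x, cs_set (L i) (D i x) -> D i x = 0.
Hypothesis D_first : forall i : 'I_n, i = 0%N :> nat -> forall x, D i x = 0 -> x = 0.
Hypothesis D_last : forall i : 'I_n, i.+1 = n -> forall y, exists x, D i x = y.
Hypothesis A_far : forall (i j : 'I_n) (ij : (i < j)%N), j != i.+1 :> nat ->
  forall x, A ij x = 0.
Hypothesis A_next : forall (i j : 'I_n) (ij : (i < j)%N), j = i.+1 :> nat ->
  [/\ forall x, cs_set (L i) (A ij x), forall x, D j x = 0 -> A ij x = 0 -> x = 0 &
      forall k u, cs_set (L i) k -> exists2 x, D j x = D j u & A ij x = k].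
Let T := upper_triangular D A.

Lemma bidiagonalE (x : dsum X) (i j : 'I_n) (ij : (i < j)%N) : j = i.+1 :> nat ->
  T x i = D i (x i) + A ij (x j).
Proof.
move=> ijS; rewrite /T /= /upper_triangular_fun; congr +%R.
rewrite (bigD1 (exist (fun j : 'I_n => (i < j)%N) j ij))//= big1 => [|k kj].
  by rewrite addr0; congr (A _ _); exact: bool_irrelevance.
apply: A_far; apply: contraNneq kj => kS; rewrite -val_eqE -val_eqE /=.
by rewrite kS ijS.
Qed.

Lemma last_or_next (i : 'I_n) : i.+1 = n \/ exists2 j : 'I_n, j = i.+1 :> nat & (i < j)%N.
Proof.
have [|iN] := eqVneq i.+1 n; first by left.
have i1n : (i.+1 < n)%N by rewrite ltn_neqAle iN ltn_ord.
by right; exists (Ordinal i1n).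
Qed.

Lemma first_or_prev (j : 'I_n) :
  j = 0%N :> nat \/ exists2 i : 'I_n, j = i.+1 :> nat & (i < j)%N.
Proof.
case: j => -[|j] jn /=; first by left.
by right; exists (Ordinal (ltnW jn)).
Qed.

(** The two terms of a row lie in the range of [D i] and in [L i], which meet only in zero, so both
    vanish. Each coordinate is then in the kernel of its diagonal entry, where the entry above it is
    injective; the first coordinate uses [D_first]. *)
Lemma bidiagonal_inj (x : dsum X) : T x = 0 -> x = 0.
Proof.
move=> Tx0.
have Dx0 i : D i (x i) = 0.
  have Ti0 : T x i = 0 by rewrite Tx0.
  have [ni|[j jS ij]] := last_or_next i.
    by move: Ti0; rewrite upper_triangular_last// => k; rewrite ltnNge -ltnS ni ltn_ord.
  have [AL _ _] := A_next ij jS.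
  move: Ti0; rewrite (bidiagonalE _ ij jS) => /eqP; rewrite addr_eq0 => /eqP DxE.
  apply: DL0; rewrite DxE -scaleN1r -[_ *: _]addr0.
  by apply: cs_linear => //; exact: cs_zero.
apply: functional_extensionality_dep => j.
have [j0|[i jS ij]] := first_or_prev j; first exact: D_first (Dx0 j).
have [_ A_inj _] := A_next ij jS; apply: A_inj => //.
have := bidiagonalE x ij jS; rewrite Tx0 Dx0 add0r => <-.
by [].
Qed.

(** Write [y i = D i (u i) + v i]. By [A_next], coordinate [j] can give [D j (u j)] in its own row
    and [v i] in the row [i] before it. *)
Lemma bidiagonal_surj (y : dsum X) : exists x, T x = y.
Proof.
have /dependent_fun_choice[u /dependent_fun_choice[v uvP]] :
  forall i, exists u v, cs_set (L i) v /\ y i = D i u + v by [].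
have /dependent_fun_choice[x xP] : forall j, exists x, D j x = D j (u j) /\
    forall (i : 'I_n) (ij : (i < j)%N), j = i.+1 :> nat -> A ij x = v i.
  move=> j; have [j0|[i jS ij]] := first_or_prev j.
    by exists (u j); split=> // i ij; rewrite j0.
  have [_ _ /(_ (v i) (u j) (uvP i).1)[x Dx Ax]] := A_next ij jS.
  exists x; split=> // i' ij' jS'.
  have ii' : i = i' by apply: val_inj; apply: succn_inj; rewrite -jS -jS'.
  by case: i' / ii' ij' jS' => ij' _; rewrite (bool_irrelevance ij' ij).
exists x; apply: functional_extensionality_dep => i; have [Lv yE] := uvP i.
have [ni|[j jS ij]] := last_or_next i.
  rewrite upper_triangular_last => [|k]; last by rewrite ltnNge -ltnS ni ltn_ord.
  have [w wE] := D_last ni (v i).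
  (* In the last row [D i] is onto, so [v i] lies in both the range and [L i], hence is zero. *)
  by rewrite (xP i).1 yE -wE (DL0 (x := w)) ?addr0// wE.
by rewrite (bidiagonalE _ ij jS) (xP i).1 (xP j).2.
Qed.
End Bidiagonal.

End Sufficiency.

(* Kc i stands for K(D_i): it is an arbitrary closed subspace, required to be a
   topological complement of the closure of R(D_i) whenever there is one. The
   indices 1, ..., n are the elements 0, ..., n - 1 of 'I_n. *)
Theorem theorem2p13 (R : realType) (n : nat)
  (X : 'I_n -> completeNormedModType R[i])
  (D : forall i : 'I_n, boundedOp (X i) (X i))
  (Kc : forall i : 'I_n, closedSubspace (X i)) :
  (2 <= n)%N ->
  (forall s : 'I_n, (0 < s)%N -> (s.+1 < n)%N -> inner_regular (D s)) ->
  (forall i : 'I_n, complemented (closure_range (D i)) ->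
     topological_complement (closure_range (D i)) (Kc i)) ->
  (((forall i : 'I_n, nat_of_ord i = 0%N -> left_invertible (D i)) /\
    (forall i : 'I_n, i.+1 = n -> right_invertible (D i)) /\
    (forall i j : 'I_n, nat_of_ord j = i.+1 ->
       isomorphic (ker (D j)) (Kc i))) ->
   exists A : strictly_upper X, invertible (upper_triangular D A))
  /\
  ((forall i : 'I_n, hilbert (X i) /\ infinite_dimensional (X i)) ->
   (exists A : strictly_upper X, invertible (upper_triangular D A)) ->
   ((forall i : 'I_n, nat_of_ord i = 0%N -> left_invertible (D i)) /\
    (forall i : 'I_n, i.+1 = n -> right_invertible (D i)) /\
    (forall i : 'I_n, (0 < i)%N ->
       ~ prec (dsum (fun s : {s : 'I_n | (s < i)%N} => Kc (val s)))
              (ker (D i))) /\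
    (forall i : 'I_n, (i.+1 < n)%N ->
       ~ prec (dsum (fun s : {s : 'I_n | (i < s)%N} => ker (D (val s))))
              (Kc i)))).
Proof.
move=> n2 D_reg Kc_compl.
(* Both implications use this: one-sided invertibility at the ends makes every [D i] inner regular,
   so each [Kc i] is a true complement of a closed range. *)
have regular : (forall i : 'I_n, nat_of_ord i = 0%N -> left_invertible (D i)) ->
    (forall i : 'I_n, i.+1 = n -> right_invertible (D i)) ->
    exists D' : forall i, boundedOp (X i) (X i),
      [/\ forall i x, D i (D' i (D i x)) = D i x,
        forall i, topological_complement (closure_range (D i)) (Kc i) &
        forall i y, exists u v, cs_set (Kc i) v /\ y = D i u + v].
  move=> Dl Dr.
  have /dependent_fun_choice[D' DD'D] i : inner_regular (D i).
    have [i0|i0] := eqVneq (i : nat) 0%N; first exact/left_invertible_inner_regular/Dl.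
    have [ni|ni] := eqVneq i.+1 n; first exact/right_invertible_inner_regular/Dr.
    by apply: D_reg; rewrite ?lt0n// ltn_neqAle ni ltn_ord.
  have compl i : topological_complement (closure_range (D i)) (Kc i).
    exact/Kc_compl/inner_regular_complemented/DD'D.
  exists D'; split=> // i y; have [/(_ y)[z [v [Dz Kv ->]]] _] := compl i.
  by have [u <-] := closure_range_range (DD'D i) Dz; exists u, v.
split=> [[Dl [Dr iso]]|_ [A [[S ST] [S' TS']]]].
  have [D' [DD'D compl decomp]] := regular Dl Dr.
  (* Covering all pairs of indices, with zero off the superdiagonal, lets the whole matrix be
     obtained by choice. *)
  pose connecting (i j : 'I_n) (B : boundedOp (X j) (X i)) : Prop :=
    if j == i.+1 :> nat then
      [/\ forall x, cs_set (Kc i) (B x), forall x, D j x = 0 -> B x = 0 -> x = 0 &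
        forall k u, cs_set (Kc i) k -> exists2 x, D j x = D j u & B x = k]
    else forall x, B x = 0.
  have A_ex i j : exists B, @connecting i j B.
    rewrite /connecting; have [ij|_] := eqVneq (j : nat) i.+1.
      by have [B BP] := connecting_operator (DD'D j) (iso _ _ ij); exists B.
    (* The zero operator, as an empty sum. *)
    by exists (bop_sum (fun k : void => match k with end)) => x; rewrite /= big1// => -[].
  have /dependent_fun_choice[A0 A0P] := fun i => dependent_fun_choice (A_ex i).
  pose A : strictly_upper X := fun i j _ => A0 i j.
  exists A.
  have DK0 i x : cs_set (Kc i) (D i x) -> D i x = 0.
    move=> Kx; have [_ MK] := compl i.
    have : (closure_range (D i) `&` Kc i) (D i x).
      by split=> //; apply: subset_closure; exists x.
    by rewrite MK.
  have D_first (i : 'I_n) : i = 0%N :> nat -> forall x, D i x = 0 -> x = 0.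
    by move=> /Dl[B BD] x Dx0; rewrite -[x]BD Dx0 linear0.
  have D_last (i : 'I_n) : i.+1 = n -> forall y, exists x, D i x = y.
    by move=> /Dr[B DB] y; exists (B y).
  have A_far (i j : 'I_n) (ij : (i < j)%N) : j != i.+1 :> nat -> forall x, A i j ij x = 0.
    by move=> /negbTE jS; have := A0P i j; rewrite /connecting jS.
  apply: bijective_invertible.
    apply: (bidiagonal_surj decomp DK0 D_last A_far).
    by move=> i j ij jS; have := A0P i j; rewrite /connecting jS eqxx.
  apply: (bidiagonal_inj DK0 D_first A_far).
  by move=> i j ij jS; have := A0P i j; rewrite /connecting jS eqxx.
have Dl i : nat_of_ord i = 0%N -> left_invertible (D i).
  exact: upper_triangular_first_left_invertible ST.
have Dr (i : 'I_n) : i.+1 = n -> right_invertible (D i).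
  exact: upper_triangular_last_right_invertible TS'.
have [D' [DD'D compl decomp]] := regular Dl Dr.
do 3 split => //; move=> i _.
  have [E E_surj] := kernel_is_image (i := i) DD'D ST (fun s y _ => decomp s y).
  exact: surj_not_prec E_surj.
have [Q [QD QK]] := complement_projection (compl i).
have QD0 x : Q (D i x) = 0 by apply: QD; apply: subset_closure; exists x.
have [G G_surj] := complement_is_image DD'D (@unipotent_right_invertible _ _ _) TS' QD0 QK.
exact: surj_not_prec G_surj.
Qed.
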